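(* Let $(L,[,],\alpha)$ be a Hom-Lie algebra over $\mathbf{k}$, let $\tau\colon L\to\mathbf{k}$ be a trace function, i.e. a linear form with $\tau([x,y])=0$ for all $x,y\in L$, and let $\beta\colon L\to L$ be a linear map such that $$\tau(\alpha(x))\tau(y)=\tau(x)\tau(\alpha(y)),\qquad \tau(\beta(x))\tau(y)=\tau(x)\tau(\beta(y)),\qquad \tau(\alpha(x))\beta(y)=\tau(\beta(x))\alpha(y)$$ for all $x,y\in L$. If $a\in L$ satisfies $\alpha(a)=a$, then $L_\tau'=(L,[,]_\tau',\beta)$ is a Hom-Lie algebra, where $$[x,y]_\tau'=\tau(a)[x,y]+[a,\tau(y)x-\tau(x)y]$$ for $x,y\in L$.
   Context: We work over a fixed field $\mathbf{k}$ of characteristic $0$. A Hom-Lie algebra $(L,[,],\alpha)$ is a $\mathbf{k}$-module $L$ with an anti-symmetric bilinear map $[,]\colon L^{\otimes 2}\to L$ and a linear map $\alpha\colon L\to L$ such that $[[x,y],\alpha(z)]+[[z,x],\alpha(y)]+[[y,z],\alpha(x)]=0$ for all $x,y,z\in L$ (no multiplicativity of $\alpha$ is assumed). *)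

(* Defs.v *)
From mathcomp Require Import all_boot all_algebra.

Set Implicit Arguments.
Unset Strict Implicit.
Unset Printing Implicit Defensive.

Import GRing.Theory.
Local Open Scope ring_scope.

(* No multiplicativity of [alpha] is required. *)
Record is_hom_lie (k : fieldType) (L : lmodType k)
    (br : L -> L -> L) (alpha : L -> L) : Prop := IsHomLie {
  hom_lie_bilinear : bilinear_for *:%R *:%R br;
  hom_lie_linear : linear alpha;
  hom_lie_antisym : forall x y : L, br x y = - br y x;
  hom_lie_jacobi : forall x y z : L,
    br (br x y) (alpha z) + br (br z x) (alpha y) + br (br y z) (alpha x) = 0
}.

Definition is_trace (k : fieldType) (L : lmodType k)
    (br : L -> L -> L) (tau : {scalar L}) : Prop :=
  forall x y : L, tau (br x y) = 0.

Definition trace_bracket (k : fieldType) (L : lmodType k)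
    (br : L -> L -> L) (tau : {scalar L}) (a x y : L) : L :=
  tau a *: br x y + br a (tau y *: x - tau x *: y).

(* Main.v *)
(** Evaluated at [a], the compatibility conditions give
    [tau a *: beta z = tau (beta a) *: alpha z] and
    [tau a * tau (beta z) = tau (beta a) * tau z], which trade [beta] for
    [alpha] in every term carrying the factor [tau a].  The Hom-Jacobi identity
    for [a, x, y], where [alpha a = a], expresses [br a (br x y)] through the
    brackets [br (br a x) (alpha y)], so these terms cancel in the cyclic sum.
    The remaining ones, multiples of [br a (br a x)], cancel because
    [tau (beta y) * tau z] is symmetric in [y] and [z]. *)
Require Import Defs.
From mathcomp Require Import all_boot all_algebra.

Import GRing.Theory.
Local Open Scope ring_scope.

Section TraceBracket.
Context {k : fieldType} {L : lmodType k} (br : L -> L -> L) (tau : {scalar L}).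
Hypothesis br_bilin : bilinear_for *:%R *:%R br.

Let brDZl c u v w : br (c *: u + v) w = c *: br u w + br v w.
Proof. exact: (br_bilin.1 w c u v). Qed.

Let brDZr c u v w : br w (c *: u + v) = c *: br w u + br w v.
Proof. exact: (br_bilin.2 w c u v). Qed.

Let br0l w : br 0 w = 0.
(* On zero vectors the scalar -1 makes the two terms on the right cancel. *)
Proof. by have := brDZl (-1) 0 0 w; rewrite scaler0 addr0 scaleN1r addNr. Qed.

Let br0r w : br w 0 = 0.
Proof. by have := brDZr (-1) 0 0 w; rewrite scaler0 addr0 scaleN1r addNr. Qed.

Let brZl c u w : br (c *: u) w = c *: br u w.
Proof. by rewrite -[c *: u]addr0 brDZl br0l addr0. Qed.

Let brZr c u w : br w (c *: u) = c *: br w u.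
Proof. by rewrite -[c *: u]addr0 brDZr br0r addr0. Qed.

Let brDl u v w : br (u + v) w = br u w + br v w.
Proof. by rewrite -[u in LHS]scale1r brDZl scale1r. Qed.

Let brDr u v w : br w (u + v) = br w u + br w v.
Proof. by rewrite -[u in LHS]scale1r brDZr scale1r. Qed.

Let brNl u w : br (- u) w = - br u w.
Proof. by rewrite -scaleN1r brZl scaleN1r. Qed.

Let brNr u w : br w (- u) = - br w u.
Proof. by rewrite -scaleN1r brZr scaleN1r. Qed.

Lemma trace_bracketE a x y :
  trace_bracket br tau a x y =
    tau a *: br x y + tau y *: br a x - tau x *: br a y.
Proof. by rewrite /trace_bracket brDr brNr !brZr addrA. Qed.

Lemma trace_bracket_antisym a :
  (forall x y, br x y = - br y x) ->
  forall x y, trace_bracket br tau a x y = - trace_bracket br tau a y x.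
Proof.
move=> br_anti x y.
by rewrite !trace_bracketE (br_anti x y) scalerN !opprD opprK addrAC.
Qed.

Lemma trace_bracket_bilinear a : bilinear_for *:%R *:%R (trace_bracket br tau a).
Proof.
split=> [w c u v|w c u v] /=; rewrite !trace_bracketE !linearP /=.
- rewrite brDZl brDZr !scalerDr scalerDl !scalerN !opprD !scalerA.
  (* Odd positions hold the terms in [u], which carry [c]; even positions hold those in [v]. *)
  by rewrite ![_ * c]mulrC (AC ((2*2)*2) ((1*3*5)*(2*4*6))).
- rewrite !brDZr !scalerDr scalerDl !scalerN !opprD !scalerA.
  by rewrite ![_ * c]mulrC (AC ((2*2)*2) ((1*3*5)*(2*4*6))).
Qed.

(** In a nested bracket this kills the term whose coefficient is the trace of the inner bracket. *)
Lemma trace_bracket_trace a :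
  is_trace br tau -> is_trace (trace_bracket br tau a) tau.
Proof.
by move=> tau0 x y; rewrite trace_bracketE !linearD linearN !linearZ /= !tau0
  !mulr0 subr0 addr0.
Qed.

Section Jacobi.
Variables (alpha beta : L -> L) (a : L).
Hypothesis alpha_a : alpha a = a.
Hypothesis br_anti : forall x y, br x y = - br y x.
Hypothesis br_jacobi : forall x y z,
  br (br x y) (alpha z) + br (br z x) (alpha y) + br (br y z) (alpha x) = 0.
Hypothesis tau_trace : is_trace br tau.
Hypothesis tau_beta : forall x y, tau (beta x) * tau y = tau x * tau (beta y).
Hypothesis tau_a_beta : forall z, tau a *: beta z = tau (beta a) *: alpha z.

(** By antisymmetry, [br a] is thus a derivation twisted by [alpha]. *)
Lemma br_fixed_br x y :
  br a (br x y) = br (br a x) (alpha y) - br (br a y) (alpha x).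
Proof.
have /eqP := br_jacobi a x y.
rewrite alpha_a (br_anti y a) (br_anti (br x y)) brNl subr_eq0.
by move=> /eqP.
Qed.

Let P x y z := tau y *: br (br a x) (alpha z).
Let Q x y z := (tau (beta y) * tau z) *: br a (br a x).

Let QC x y z : Q x y z = Q x z y.
Proof. by rewrite /Q tau_beta mulrC. Qed.

Lemma trace_bracket2E x y z :
  trace_bracket br tau a (trace_bracket br tau a x y) (beta z) =
    (tau (beta a) * tau a) *: br (br x y) (alpha z)
    + tau (beta a) *: (P x y z - P y x z + P x z y - P y z x)
    + (Q x z y - Q y z x).
Proof.
rewrite [LHS]trace_bracketE trace_bracket_trace // scale0r subr0.
(* The factor [tau a] is moved next to [beta z] so that [beta] can be exchanged for [alpha]. *)
rewrite -brZr tau_a_beta brZr trace_bracketE.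
rewrite !(brDl, brDr, brNl, brNr, brZl, brZr) !scalerDr !scalerN !scalerA.
(* The coefficient of [br a (br x y)] also acquires the factor [tau (beta a)], so the twisted
   derivation rule turns this term into [P] terms with the common factor. *)
rewrite (tau_beta z a) [tau z * tau (beta a)]mulrC.
rewrite -[_ *: br a (br x y)]scalerA br_fixed_br /P /Q.
by rewrite !scalerDr !scalerN !scalerA !addrA.
Qed.

Lemma trace_bracket_jacobi x y z :
  let br' := trace_bracket br tau a in
  br' (br' x y) (beta z) + br' (br' z x) (beta y) + br' (br' y z) (beta x) = 0.
Proof.
move=> /=; rewrite !trace_bracket2E.
rewrite (AC (3*3*3) ((1*4*7)*(2*5*8)*(3*6*9))) /= -!scalerDr br_jacobi scaler0.
rewrite (QC x z y) (QC z y x) (QC y x z) add0r.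
(* Each pair matches a [P] term from expanding an inner bracket with one from the derivation rule in
   another cyclic summand. *)
rewrite [X in _ *: X](AC (4*4*4)
  ((1*8)*(11*2)*(3*6)*(9*4)*(5*12)*(7*10))) /=.
rewrite [X in _ + X](AC (2*2*2) ((1*4)*(3*6)*(5*2))) /=.
by rewrite !subrr !addr0 scaler0.
Qed.

End Jacobi.
End TraceBracket.

Theorem corollary6p7 (k : fieldType) (char0 : [pchar k] =i pred0)
    (L : lmodType k) (br : L -> L -> L) (alpha : {linear L -> L})
    (homL : is_hom_lie br alpha)
    (tau : {scalar L}) (tau_trace : is_trace br tau)
    (beta : {linear L -> L})
    (tau_alpha : forall x y : L, tau (alpha x) * tau y = tau x * tau (alpha y))
    (tau_beta : forall x y : L, tau (beta x) * tau y = tau x * tau (beta y))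
    (tau_alpha_beta : forall x y : L,
       tau (alpha x) *: beta y = tau (beta x) *: alpha y)
    (a : L) (alpha_a : alpha a = a) :
  is_hom_lie (trace_bracket br tau a) beta.
Proof.
have [br_bilin _ br_anti br_jacobi] := homL.
split.
- exact: trace_bracket_bilinear.
- exact: linearP.
- exact: trace_bracket_antisym.
- apply: (trace_bracket_jacobi _ _ br_bilin alpha) => // z.
  (* The mixed condition is taken at [a], where [tau (alpha a)] is [tau a]. *)
  by rewrite -tau_alpha_beta alpha_a.
Qed.
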